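(* Let $m,n$ be positive integers with $m\geq2$. Then for $1\leq k\leq n$, $$E(mn,k)=\sum_{\substack{p+q=n\\ p,q\geq0}}(-1)^{p-k}\binom{p}{k}P_p\big(\zeta(m),-\zeta(2m),\ldots,(-1)^{p+1}\zeta(pm)\big)\,P_q\big(\zeta(m),\zeta(2m),\ldots,\zeta(qm)\big).$$
   Context: $\zeta(s)=\sum_{n\geq1}n^{-s}$ is the Riemann zeta function and $\zeta(\alpha_1,\ldots,\alpha_k)=\sum_{1\leq k_1<\cdots<k_k}k_1^{-\alpha_1}\cdots k_k^{-\alpha_k}$. $E(mn,k)=\sum\zeta(m\alpha_1,\ldots,m\alpha_k)$ over all $k$-tuples of positive integers with $\alpha_1+\cdots+\alpha_k=n$. The modified Bell polynomials $P_j$ are defined by $\exp\left(\sum_{k\geq1}\frac{x_k}{k}z^k\right)=\sum_{j\geq0}P_j(x_1,\ldots,x_j)z^j$, i.e. $P_j(x_1,\ldots,x_j)=\sum_{k_1+2k_2+\cdots+jk_j=j}\prod_{i=1}^j\frac{1}{k_i!}\left(\frac{x_i}{i}\right)^{k_i}$, with $P_0=1$. $\binom{p}{k}=0$ for $p<k$. *)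

(* Defs.v *)
From HB Require Import structures.
From mathcomp Require Import all_boot all_order all_algebra.
From mathcomp Require Import all_classical all_reals all_analysis.

Set Implicit Arguments.
Unset Strict Implicit.
Unset Printing Implicit Defensive.

Import Order.TTheory GRing.Theory Num.Theory.
Import numFieldNormedType.Exports.

Local Open Scope classical_set_scope.
Local Open Scope ring_scope.

(* The Riemann zeta function at a natural number; as a limit in R, this is only
   meaningful when the series converges, that is for s >= 2. *)
Definition zeta (R : realType) (s : nat) : R :=
  limn (fun N => \sum_(1 <= n < N) n%:R ^- s : R).

Definition increasing_indices (k : nat) : set {ffun 'I_k -> nat} :=
  [set t : {ffun 'I_k -> nat} |
     (forall i, (0 < t i)%N) /\ (forall i j : 'I_k, (i < j)%N -> (t i < t j)%N)].

(* zeta(a_1, ..., a_k), in the convention where the summation indices increase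
   from left to right.  All terms are nonnegative, so the multiple series is
   taken as an unordered sum with values in [0, +oo]. *)
Definition mzeta (R : realType) (k : nat) (a : 'I_k -> nat) : \bar R :=
  (\esum_(t in @increasing_indices k) (\prod_(i < k) (t i)%:R ^- a i)%:E)%E.

(* E(mn, k).  The parts of a composition of n are at most n, which makes the
   index type finite. *)
Definition Esum (R : realType) (m n k : nat) : \bar R :=
  (\sum_(a : {ffun 'I_k -> 'I_n.+1}
        | [forall i, (0 < a i)%N] && ((\sum_(i < k) a i)%N == n))
     mzeta R (fun i => (m * a i)%N))%E.

(* The modified Bell polynomial P_j(x_1, ..., x_j), where x 0 is not used and
   the exponent k_(i+1) is stored at the index i : 'I_j; each exponent is at
   most j because of the constraint. *)
Definition bellP (R : realType) (j : nat) (x : nat -> R) : R :=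
  \sum_(k : {ffun 'I_j -> 'I_j.+1} | (\sum_(i < j) i.+1 * k i)%N == j)
     \prod_(i < j) (((k i)`!)%:R^-1 * (x i.+1 / i.+1%:R) ^+ k i).

(* Main.v *)
(** Write [u_s = (s+1)^-m], truncate all series to [s < N] and let [y] mark the
    depth [k].  The truncation of [\sum_(n, k) E(mn, k) y^k z^n] is the product
    over [s < N] of
      [1 + y u_s z / (1 - u_s z) = (1 + (y - 1) u_s z) / (1 - u_s z)].
    The coefficient of [z^p] in [\prod_s (1 + (y - 1) u_s z)] is [(y - 1)^p] times
    the elementary symmetric function [e_p], and that of [z^q] in
    [\prod_s 1 / (1 - u_s z)] is the complete homogeneous one [h_q].  Comparing
    logarithmic derivatives shows that [e_p] and [h_q] are the Bell polynomials
    [P_p] and [P_q] at the (signed) power sums [\sum_s u_s^i], which tend to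
    [zeta(i m)] as [N] grows.  Power series are handled as polynomials modulo a
    power of the variable. *)

Require Import Defs.
From HB Require Import structures.
From mathcomp Require Import all_boot all_order all_algebra.
From mathcomp Require Import ring lra zify.
From mathcomp Require Import all_classical all_reals all_analysis.

Set Implicit Arguments.
Unset Strict Implicit.
Unset Printing Implicit Defensive.

Import Order.TTheory GRing.Theory Num.Theory.
Import numFieldNormedType.Exports.

Local Open Scope classical_set_scope.
Local Open Scope ring_scope.

(** * Power series modulo [X^M] and their logarithmic derivatives *)

Definition trunc_eq (A : nzRingType) (M : nat) (p q : {poly A}) :=
  forall i, (i < M)%N -> p`_i = q`_i.

Lemma trunc_eqM (A : nzRingType) M (p p' q q' : {poly A}) :
  trunc_eq M p p' -> trunc_eq M q q' -> trunc_eq M (p * q) (p' * q').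
Proof.
move=> pp' qq' i iM; rewrite !coefM; apply: eq_bigr => j _.
by rewrite pp' ?qq' // (leq_ltn_trans _ iM) // ?leq_subr // -ltnS.
Qed.

Lemma trunc_eq_prod (A : nzRingType) M I (r : seq I) (F G : I -> {poly A}) :
  (forall i, trunc_eq M (F i) (G i)) ->
  trunc_eq M (\prod_(i <- r) F i) (\prod_(i <- r) G i).
Proof.
move=> FG; elim/big_ind2: _ => // p p' q q'; exact: trunc_eqM.
Qed.

(** The relation p'/p = s modulo [X^M], written without division. *)
Definition trunc_logder (A : nzRingType) (M : nat) (p : {poly A})
    (s : nat -> A) :=
  trunc_eq M p^`() (p * \poly_(i < M) s i).

Lemma trunc_logder_prod (A : comNzRingType) M I (r : seq I) (F : I -> {poly A})
    (s : I -> nat -> A) :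
  (forall i, trunc_logder M (F i) (s i)) ->
  trunc_logder M (\prod_(i <- r) F i) (fun l => \sum_(i <- r) s i l).
Proof.
move=> Fs; elim: r => [|a r IH].
  rewrite big_nil => i iM; rewrite derivC mul1r coef0 coef_poly iM.
  by rewrite big_nil.
rewrite big_cons => i iM; rewrite derivM coefD.
rewrite (trunc_eqM (Fs a) (fun _ _ => erefl) iM).
rewrite (trunc_eqM (fun _ _ => erefl) IH iM) -coefD.
rewrite mulrAC mulrA -mulrDr; congr (polyseq (_ * _))`_i.
by apply/polyP => l; rewrite coefD !coef_poly big_cons; case: ifP; rewrite ?addr0.
Qed.

(** The relation expresses [i.+1] times coefficient [i.+1] through the coefficients up to [i], and
    [i.+1] can be cancelled in characteristic zero. Integrating gains one degree, hence [M.+1]. *)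
Lemma trunc_logder_uniq (A : numDomainType) M (p q : {poly A}) (s : nat -> A) :
  p`_0 = q`_0 -> trunc_logder M p s -> trunc_logder M q s ->
  trunc_eq M.+1 p q.
Proof.
move=> pq0 ps qs i; elim/ltn_ind: i => -[//|i] IH; rewrite ltnS => iM.
have := ps i iM; have := qs i iM; rewrite !coef_deriv => qi pi.
have /mulIf inj : i.+1%:R != 0 :> A by rewrite pnatr_eq0.
apply: inj; rewrite /= !mulr_natr pi qi !coefM; apply: eq_bigr => j _.
by rewrite IH // (leq_trans (ltn_ord j)) // ltnW.
Qed.

(** * Bell polynomials as coefficients of an exponential *)

Lemma bellP_coef (R : realType) (j : nat) (x : nat -> R) :
  bellP j x = (\prod_(i < j) \sum_(c < j.+1)
     ((c`!)%:R^-1 * (x i.+1 / i.+1%:R) ^+ c) *: 'X^(i.+1 * c))`_j.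
Proof.
(* Expanding the product picks one exponent [k i] from each truncated exponential; the power of [X]
   records the weight of [k]. *)
rewrite bigA_distr_bigA coef_sum /bellP big_mkcond; apply: eq_bigr => k _.
rewrite [in RHS]scaler_prod [in RHS]prodrXr coefZ coefXn eq_sym.
by case: eqP => _; rewrite ?mulr1 ?mulr0.
Qed.

(** The polynomial truncates exp(v X^(i+1)), whose logarithmic derivative is the monomial (i+1) v
    X^i. *)
Lemma trunc_logder_exp (R : realType) (M i : nat) (v : R) : (i < M)%N ->
  trunc_logder M (\sum_(c < M.+1) ((c`!)%:R^-1 * v ^+ c) *: 'X^(i.+1 * c))
    (fun l => if l == i then v * i.+1%:R else 0).
Proof.
move=> iM l lM.
have -> : \poly_(l < M) (if l == i then v * i.+1%:R else 0)
          = (v * i.+1%:R) *: 'X^i.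
  apply/polyP => a; rewrite coef_poly coefZ coefXn.
  by case: eqP => [->|_]; rewrite ?iM ?mulr1 ?mulr0 // if_same.
have scaleXM (a b : R) d e : (a *: 'X^d) * (b *: 'X^e) = (a * b) *: 'X^(d + e).
  by rewrite -scalerAl -scalerAr scalerA -exprD.
rewrite raddf_sum big_ord_recl big_ord_recr mulrDl coefD /=.
rewrite muln0 derivZ derivXn mulr0n scaler0 coef0 add0r.
rewrite coefD scaleXM coefZ coefXn.
(* The product with the last term, [c = M], has degree at least [M]. The other terms match the
   derivatives of the terms [c.+1]. *)
rewrite [_ == _ :> nat]ltn_eqF ?mulr0 ?addr0; last first.
  by rewrite (leq_trans lM) // mulSn -addnA leq_addr.
rewrite mulr_suml; congr (polyseq _)`_l; apply: eq_bigr => c _.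
rewrite /bump /= add1n scaleXM derivZ derivXn.
rewrite -scalerMnr scalerMnl -mulr_natr.
rewrite mulnS addSn addnC -pred_Sn.
congr (_ *: 'X^_).
rewrite factS natrM invfM exprSr.
rewrite -addnS -mulnSr natrM.
have c0 : c.+1%:R != 0 :> R by rewrite pnatr_eq0.
by field; rewrite nat1r c0 pnatr_eq0 -lt0n fact_gt0.
Qed.

Lemma bellP_uniq (R : realType) (j : nat) (x : nat -> R) (p : {poly R}) :
  p`_0 = 1 -> trunc_logder j p (fun i => x i.+1) -> bellP j x = p`_j.
Proof.
move=> p0 px; rewrite bellP_coef.
apply: (trunc_logder_uniq (s := fun i => x i.+1) (M := j)) => //.
  rewrite p0 -horner_coef0 horner_prod big1 // => i _.
  rewrite horner_sum big_ord_recl big1 ?addr0 => [|c _].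
    by rewrite muln0 !expr0 hornerZ hornerC fact0 invr1 !mulr1.
  by rewrite hornerZ hornerXn expr0n mulr0.
move=> l lj; rewrite (trunc_logder_prod (M := j) _ (s := fun (i : 'I_j) l =>
  if l == i then x i.+1 / i.+1%:R * i.+1%:R else 0)) //; last first.
  by move=> i; apply: trunc_logder_exp.
congr (polyseq (_ * _))`_l; apply/polyP => a; rewrite !coef_poly.
case: ifP => // aj; rewrite (bigD1 (Ordinal aj)) //= eqxx big1 ?addr0.
  by rewrite divfK // pnatr_eq0.
by move=> i; rewrite eq_sym -val_eqE /= => /negPf ->.
Qed.

Lemma coef0_prod (A : comNzRingType) I (r : seq I) (F : I -> {poly A}) :
  (\prod_(i <- r) F i)`_0 = \prod_(i <- r) (F i)`_0.
Proof.
rewrite -horner_coef0 horner_prod.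
by apply: eq_bigr => i _; rewrite horner_coef0.
Qed.

(** The logarithmic derivative of 1 + uX is u/(1 + uX), with coefficients (-1)^i u^(i+1); this sign
    equals (-1)^(i+2), the one attached to the power sum of index i+1. *)
Lemma bellP_elementary (R : realType) (p N : nat) (u : nat -> R) :
  bellP p (fun i => (-1) ^+ i.+1 * \sum_(s < N) u s ^+ i) =
  (\prod_(s < N) (1 + u s *: 'X))`_p.
Proof.
apply: bellP_uniq.
  by rewrite coef0_prod big1 // => i _; rewrite coefD coef1 coefZ coefX mulr0 addr0.
move=> l lp; rewrite (trunc_logder_prod (M := p) _ (s := fun (s : 'I_N) i =>
  (-1) ^+ i * u s ^+ i.+1)) //.
  congr (polyseq (_ * _))`_l; apply: eq_poly => i _.
  by rewrite mulr_sumr; apply: eq_bigr => s _; rewrite !exprS mulrA mulrNN mulr1 mul1r.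
move=> s [|i] iM; rewrite mulrDl mul1r coefD coef_deriv coefD coef1 coefZ coefX;
  rewrite -scalerAl coefZ coefXM !coef_poly iM /=.
  by ring.
by rewrite (ltnW iM) 2!exprS; ring.
Qed.

(** The factors truncate 1/(1 - uX). The free bound [M] allows one truncation to serve all [q] at
    once. *)
Lemma bellP_homogeneous (R : realType) (q M N : nat) (u : nat -> R) :
  (q <= M)%N ->
  bellP q (fun i => \sum_(s < N) u s ^+ i) =
  (\prod_(s < N) \poly_(c < M.+1) (u s ^+ c))`_q.
Proof.
move=> qM; apply: bellP_uniq.
  by rewrite coef0_prod big1 // => i _; rewrite coef_poly expr0.
apply: trunc_logder_prod => s i iq.
(* The convolution on the right consists of [i.+1] terms, all equal to [u s ^+ i.+1]. *)
rewrite coef_deriv coefM coef_poly ltnS (leq_trans iq qM).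
rewrite (eq_bigr (fun=> u s ^+ i.+1)) ?sumr_const ?card_ord // => j _.
rewrite !coef_poly (leq_trans (ltn_ord j)) ?(leq_trans iq) ?(leqW qM) //.
rewrite (leq_ltn_trans _ iq) ?leq_subr // -exprD addnS subnKC //.
by rewrite -ltnS.
Qed.

(** * The generating function in two variables *)

Lemma coef_prod_scaled (A : comNzRingType) (c : {poly A}) I (r : seq I)
    (u : I -> A) p :
  (\prod_(i <- r) (1 + (c * (u i)%:P) *: 'X))`_p =
  c ^+ p * ((\prod_(i <- r) (1 + u i *: 'X))`_p)%:P.
Proof.
elim: r p => [|a r IH] p.
  by rewrite !big_nil !coef1; case: p => [|p]; rewrite ?mul1r ?polyC0 ?mulr0.
rewrite !big_cons !mulrDl !mul1r !coefD -!scalerAl !coefZ !coefXM !IH.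
case: p => [|p] /=; first by rewrite !mulr0 !addr0.
rewrite polyCD polyCM exprS; ring.
Qed.

(** Binomial theorem. The integer exponent is negative only for [p < k], where both sides vanish. *)
Lemma coef_subX1_exp (F : fieldType) p k :
  (('X - 1) ^+ p : {poly F})`_k = (-1) ^ (p%:Z - k%:Z) * ('C(p, k))%:R.
Proof.
rewrite addrC exprDn coef_sum.
have [kp|pk] := leqP k p; last first.
  rewrite bin_small // mulr0 big1 // => i _.
  rewrite -polyC1 -polyCN -polyC_exp coefMn coefCM coefXn.
  by rewrite gtn_eqF ?mulr0 ?mul0rn // (leq_ltn_trans _ pk) // -ltnS.
rewrite -ltnS in kp; rewrite (bigD1 (Ordinal kp)) //= big1 ?addr0 => [|i].
  rewrite -polyC1 -polyCN -polyC_exp coefMn coefCM coefXn eqxx mulr1.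
  by rewrite -[LHS]mulr_natr subzn // mul1r.
rewrite -val_eqE /= => /negPf ik.
by rewrite -polyC1 -polyCN -polyC_exp coefMn coefCM coefXn eq_sym ik mulr0 mul0rn.
Qed.

(* The outer polynomial variable is z, the inner one is y. *)
Lemma sum_card_prod_coef (R : realType) (N n k : nat) (g : 'I_N -> {poly R}) :
  \sum_(S : {set 'I_N} | #|S| == k) (\prod_(s in S) g s)`_n =
  ((\prod_(s < N) (1 + 'X%:P * map_poly polyC (g s)))`_n)`_k.
Proof.
under [in RHS]eq_bigr do rewrite addrC.
rewrite bigA_distr !coef_sum big_mkcond; apply: eq_bigr => S _.
rewrite -big_mkcond /= big_split /= prodr_const -rmorph_prod -rmorphXn.
rewrite coefCM coef_map coefMC coefXn eq_sym.
by case: eqP => _; rewrite ?mul1r ?mul0r.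
Qed.

Lemma geometric_trunc (A : comNzRingType) M (x : A) :
  trunc_eq M ((1 - x *: 'X) * \poly_(c < M) x ^+ c) 1.
Proof.
move=> [|i] iM; rewrite mulrBl mul1r coefB -scalerAl coefZ coefXM coef1 coef_poly.
  by rewrite iM mulr0 subr0.
by rewrite coef_poly iM (ltnW iM) exprS subrr.
Qed.

Lemma sum_subsets_coef (R : realType) (N n k : nat) (u : nat -> R) :
  \sum_(S : {set 'I_N} | #|S| == k)
     (\prod_(s in S) \sum_(c < n.+1 | (0 < c)%N) u s ^+ c *: 'X^c)`_n =
  \sum_(p < n.+1) (-1) ^ (p%:Z - k%:Z) * ('C(p, k))%:R
     * bellP p (fun i => (-1) ^+ i.+1 * \sum_(s < N) u s ^+ i)
     * bellP (n - p) (fun i => \sum_(s < N) u s ^+ i).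
Proof.
rewrite sum_card_prod_coef.
(* [G s] and [D s] are mutually inverse modulo z^(n+1), so multiplying by [D s] replaces
   division. *)
pose G s : {poly {poly R}} := map_poly polyC (\poly_(c < n.+1) u s ^+ c).
pose D s : {poly {poly R}} := 1 - (u s)%:P *: 'X.
have DG s : trunc_eq n.+1 (D s * G s) 1.
  have -> : G s = \poly_(c < n.+1) (u s)%:P ^+ c.
    apply/polyP => i; rewrite coef_map !coef_poly.
    by case: ifP => _ /=; rewrite ?polyC0 ?polyC_exp.
  exact: geometric_trunc.
have gE (s : 'I_N) : map_poly polyC (\sum_(c < n.+1 | (0 < c)%N) u s ^+ c *: 'X^c)
    = G s - 1.
  rewrite /G poly_def [in RHS](bigD1 ord0) //= expr0 scale1r.
  rewrite rmorphD rmorph1 addrC addKr; congr map_poly.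
  by apply: eq_bigl => c; rewrite -val_eqE lt0n.
have DW (s : 'I_N) : trunc_eq n.+1 (D s * (1 + 'X%:P * (G s - 1)))
    (1 + (('X - 1) * (u s)%:P) *: 'X).
  (* Once [D s * G s] is replaced by 1, this is (1 - y)(1 - uz) + y = 1 + (y - 1)uz. *)
  have -> : D s * (1 + 'X%:P * (G s - 1)) = (1 - 'X%:P) * D s + 'X%:P * (D s * G s).
    by ring.
  move=> i iN; rewrite coefD coefCM DG // -coefCM -coefD mulr1 /D.
  congr (polyseq _)`_i; rewrite -!mul_polyC polyCM polyCB polyC1; ring.
under eq_bigr do rewrite gE.
set W := \prod_(s < N) _.
have -> : W`_n = ((\prod_(s < N) (1 + (('X - 1) * (u s)%:P) *: 'X))
                   * \prod_(s < N) G s)`_n.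
  pose DN := \prod_(s < N) D s.
  have DGN : trunc_eq n.+1 (DN * \prod_(s < N) G s) 1.
    rewrite -big_split /=; have := trunc_eq_prod (index_enum 'I_N) DG.
    by rewrite [X in trunc_eq _ _ X]big1.
  have DWN := trunc_eq_prod (index_enum 'I_N) DW; rewrite big_split /= in DWN.
  (* Insert [DN] times the product of the [G s], which is 1 modulo z^(n+1), then regroup [DN] with
     [W]. *)
  have e1 : trunc_eq n.+1 (W * (DN * \prod_(s < N) G s)) (W * 1).
    exact: trunc_eqM.
  rewrite -[W]mulr1 -e1 // mulrA [W * _]mulrC.
  exact: (trunc_eqM DWN (fun _ _ => erefl)).
rewrite coefM coef_sum; apply: eq_bigr => p _.
rewrite coef_prod_scaled -rmorph_prod coef_map [in LHS]/= -[in LHS]mulrA -polyCM coefMC.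
rewrite coef_subX1_exp bellP_elementary (bellP_homogeneous (M := n)) ?leq_subr //.
by rewrite mulrA.
Qed.

(** * Convergence of the truncated zeta values *)

Lemma sum_inv_sqr_le2 (R : realType) N :
  \sum_(i < N) (i.+1%:R : R) ^- 2 <= 2.
Proof.
(* The sharper bound makes the induction work: 1/(k+2)^2 is at most 1/((k+1)(k+2)), which
   telescopes. *)
suff H k : \sum_(i < k.+1) (i.+1%:R : R) ^- 2 <= 2 - k.+1%:R^-1.
  case: N => [|N]; first by rewrite big_ord0.
  by apply: le_trans (H N) _; rewrite gerBl invr_ge0.
elim: k => [|k IH]; first by rewrite big_ord1 expr1n invr1; lra.
rewrite big_ord_recr /=; apply: le_trans (lerD IH (lexx _)) _.
have a0 : 0 < k.+1%:R :> R by [].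
have b0 : 0 < k.+2%:R :> R by [].
suff : k.+2%:R ^- 2 <= k.+1%:R^-1 - k.+2%:R^-1 :> R.
  by move: (k.+2%:R ^- 2) (k.+1%:R^-1) (k.+2%:R^-1) => a b c; lra.
have -> : k.+1%:R^-1 - k.+2%:R^-1 = (k.+1%:R * k.+2%:R)^-1 :> R.
  rewrite -[k.+2]addn1 natrD in b0 *; field.
  by rewrite !gt_eqF.
by rewrite lef_pV2 ?posrE ?exprn_gt0 ?mulr_gt0 // expr2 ler_pM2r // ler_nat.
Qed.

Lemma cvg_zeta (R : realType) s : (2 <= s)%N ->
  (fun N => \sum_(i < N) (i.+1%:R : R) ^- s) @ \oo --> zeta R s.
Proof.
move=> s2; set w := fun N : nat => _.
have /cvg_ex[l wl] : cvgn w.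
  apply: nondecreasing_is_cvgn.
    apply/nondecreasing_seqP => N; rewrite /w big_ord_recr /= lerDl invr_ge0.
    exact: exprn_ge0.
  exists 2 => _ [N _ <-]; apply: le_trans (sum_inv_sqr_le2 _ N).
  apply: ler_sum => i _; rewrite lef_pV2 ?posrE ?exprn_gt0 //.
  by rewrite ler_weXn2l // ler1n.
suff zl : (fun N => \sum_(1 <= n < N) (n%:R : R) ^- s) @ \oo --> l.
  by rewrite /zeta (cvg_lim _ zl).
(* Shifting [N] by one aligns the sum over [1 <= n < N] with the sum over [i < N] of terms at
   [i.+1]. *)
rewrite -cvg_shiftS; under eq_fun do rewrite big_add1 big_mkord.
exact: wl.
Qed.

Lemma cvg_bellP (R : realType) j (xs : nat -> nat -> R) (x : nat -> R) :
  (forall i, (0 < i)%N -> (fun N => xs N i) @ \oo --> x i) ->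
  (fun N => bellP j (xs N)) @ \oo --> bellP j x.
Proof.
move=> xsx; rewrite /bellP.
apply: cvg_big => [|k _]; first exact: add_continuous.
apply: cvg_big => [|i _]; first exact: mul_continuous.
apply: cvgM; first exact: cvg_cst.
apply: (@cvg_comp _ _ _ _ (fun y : R => y ^+ k i)); last exact: exprn_continuous.
by apply: cvgM; [exact: xsx|exact: cvg_cst].
Qed.

(** * Truncation of multiple sums, and index tuples as finite subsets *)

Definition bounded_indices (k N : nat) : set {ffun 'I_k -> nat} :=
  @increasing_indices k `&` [set t | forall i, (t i <= N)%N].
Arguments bounded_indices : clear implicits.

Lemma le_esum_subset (R : realType) (T : choiceType) (A B : set T)
    (f : T -> \bar R) : A `<=` B ->
  (\esum_(t in A) f t <= \esum_(t in B) f t)%E.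
Proof.
move=> AB; apply: ge_ereal_sup => _ [X [finX XA] <-].
by apply: esum_ge; exists X => //; split=> //; exact: subset_trans AB.
Qed.

(** An unordered sum is a supremum over finite sets of tuples, and each such set lies in some
    [bounded_indices k N]. *)
Lemma esum_increasing_indices (R : realType) k
    (f : {ffun 'I_k -> nat} -> \bar R) :
  (forall t, 0 <= f t)%E ->
  (fun N => \esum_(t in bounded_indices k N) f t)%E @ \oo -->
  (\esum_(t in @increasing_indices k) f t)%E.
Proof.
move=> f0.
suff -> : (\esum_(t in @increasing_indices k) f t)%E =
    ereal_sup (range (fun N => \esum_(t in bounded_indices k N) f t)%E).
  apply: ereal_nondecreasing_cvgn => M N MN; apply: le_esum_subset => //.
  by move=> t [tk tM]; split=> // i; exact: leq_trans MN.
apply/eqP; rewrite eq_le; apply/andP; split; last first.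
  by apply: ge_ereal_sup => _ [N _ <-]; apply: le_esum_subset => // t [].
apply: ge_ereal_sup => _ [X [finX Xk] <-].
have [N XN] : exists N, forall t, X t -> forall i, (t i <= N)%N.
  have /finite_seqP[r ->] := finX.
  exists (\max_(t <- r) \max_i t i)%N => t tr i.
  apply: leq_trans (leq_bigmax_seq _ tr isT).
  exact: (leq_bigmax_cond (F := fun i => t i)).
apply: le_trans (ereal_sup_ubound _); last by exists N.
apply: esum_ge; exists X => //; split=> // t Xt; split; first exact: Xk.
exact: XN.
Qed.

(** The element [s] of ['I_N] stands for the summation index [s.+1]. The default 0 of [nth] is not
    reached when [#|S| = k]. *)
Definition subset_indices (k N : nat) (S : {set 'I_N}) : {ffun 'I_k -> nat} :=
  [ffun i : 'I_k => (nth 0%N (map val (enum S)) i).+1].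
Arguments subset_indices k {N} S.

Lemma sorted_enum_set N (S : {set 'I_N}) : sorted ltn (map val (enum S)).
Proof.
rewrite /enum_mem -enumT sorted_map; apply: sorted_filter.
  by move=> a b c; exact: ltn_trans.
by rewrite -(sorted_map (f := val) (e' := ltn)) val_enum_ord iota_ltn_sorted.
Qed.

Lemma set_bij_subset_indices k N :
  set_bij [set S : {set 'I_N} | #|S| = k] (bounded_indices k N)
    (subset_indices k).
Proof.
have szE (S : {set 'I_N}) : #|S| = k -> size (map val (enum S)) = k.
  by move=> Sk; rewrite size_map -cardE.
split.
- move=> S /= Sk; split; [split|] => i; rewrite /= ?ffunE //.
    move=> j ij; rewrite !ffunE ltnS.
    by apply: (sorted_ltn_nth ltn_trans) => //; rewrite ?sorted_enum_set ?inE ?szE.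
  have : nth 0%N (map val (enum S)) i \in map val (enum S).
    by apply: mem_nth; rewrite szE.
  by case/mapP => j _ ->; exact: ltn_ord.
- move=> S S'; rewrite !inE => Sk S'k SS'.
  have : map val (enum S) = map val (enum S').
    apply: (@eq_from_nth _ 0%N); rewrite !szE // => i ik.
    by have /ffunP/(_ (Ordinal ik)) := SS'; rewrite !ffunE => -[].
  move=> /(inj_map val_inj) eS; apply/setP => s.
  by rewrite -mem_enum eS mem_enum.
- move=> t [[t0 tlt] tN].
  pose S : {set 'I_N} := finset (fun j : 'I_N => [exists i, t i == j.+1]).
  (* Two strictly increasing lists with the same members coincide. *)
  have eS : map val (enum S) = [seq (t i).-1 | i <- enum 'I_k].
    apply: (irr_sorted_eq ltn_trans ltnn).
    + exact: sorted_enum_set.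
    + rewrite sorted_map; apply: (@sub_sorted _ (relpre val ltn)).
        move=> i j /= ij; rewrite -ltnS !prednK ?t0 //; exact: tlt.
      by rewrite -(sorted_map (f := val) (e' := ltn)) val_enum_ord iota_ltn_sorted.
    + move=> a; apply/mapP/mapP => [[j]|[i _ ->]].
        rewrite mem_enum inE => /existsP[i /eqP ti] ->.
        by exists i; rewrite ?mem_enum ?ti.
      have tiN : ((t i).-1 < N)%N by rewrite prednK ?t0 ?tN.
      exists (Ordinal tiN) => //.
      by rewrite mem_enum inE; apply/existsP; exists i; rewrite /= prednK ?t0.
  have Sk : #|S| = k.
    by rewrite cardE -(size_map val) eS size_map size_enum_ord.
  exists S => //; apply/ffunP => i.
  rewrite ffunE eS (nth_map i) ?size_enum_ord // nth_ord_enum prednK ?t0 //.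
Qed.

Lemma esum_bounded_indices (R : realType) k N
    (f : {ffun 'I_k -> nat} -> R) : (forall t, 0 <= f t) ->
  (\esum_(t in bounded_indices k N) (f t)%:E)%E =
  (\sum_(S : {set 'I_N} | #|S| == k) f (subset_indices k S))%:E.
Proof.
move=> f0; rewrite (@reindex_esum _ _ _ _ _ _ _ (set_bij_subset_indices k N)).
have -> : [set S : {set 'I_N} | #|S| = k]
    = [set` (fun S => #|S| == k) : {pred {set 'I_N}}].
  by apply/seteqP; split=> S /=; rewrite ?inE => /eqP.
rewrite esum_fset => [||S _]; [|exact: finite_finset|by rewrite lee_fin].
rewrite -(bigfs _ (r := index_enum {set 'I_N})) ?index_enum_uniq // => [|S _].
  exact: sumEFin.
by rewrite mem_index_enum.
Qed.

(** * Summing over compositions for a fixed index tuple *)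

Definition composition_sum (R : realType) m n k (t : 'I_k -> nat) : R :=
  \sum_(a : {ffun 'I_k -> 'I_n.+1}
        | [forall i, (0 < a i)%N] && ((\sum_(i < k) a i)%N == n))
     \prod_(i < k) (t i)%:R ^- (m * a i).

(** Expanding the product picks a part [c > 0] for each element of [S]; the coefficient of degree
    [n] keeps the choices with total [n]. *)
Lemma sum_compositions (R : realType) m n k N (S : {set 'I_N}) : #|S| = k ->
  composition_sum R m n (subset_indices k S) =
  (\prod_(s in S) \sum_(c < n.+1 | (0 < c)%N)
     ((s.+1%:R : R) ^- m) ^+ c *: 'X^c)`_n.
Proof.
move=> Sk.
pose g s : {poly R} := \sum_(c < n.+1 | (0 < c)%N) ((s.+1%:R : R) ^- m) ^+ c *: 'X^c.
have -> : \prod_(s in S) \sum_(c < n.+1 | (0 < c)%N)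
    ((s.+1%:R : R) ^- m) ^+ c *: 'X^c = \prod_(s <- map val (enum S)) g s.
  by rewrite big_map big_enum.
rewrite (big_nth 0%N) size_map -cardE Sk big_mkord.
rewrite /composition_sum bigA_distr_big coef_sum [LHS]big_mkcondr /=.
apply: eq_big => [a|a _].
  by apply/forallP/familyP => a0 i; exact: a0.
rewrite [in RHS]scaler_prod [in RHS]prodrXr coefZ coefXn eq_sym.
case: eqP => _; rewrite ?mulr0 // mulr1; apply: eq_bigr => i _.
by rewrite ffunE exprVn exprM.
Qed.

(** All terms are nonnegative, so the finite sum over compositions moves inside the unordered
    sum. *)
Lemma EsumE (R : realType) m n k : Esum R m n k =
  (\esum_(t in @increasing_indices k)
    (composition_sum R m n t)%:E)%E.
Proof.
rewrite /Esum /mzeta -esum_sum => [|t a _ _]; last first.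
  by rewrite lee_fin prodr_ge0 // => i _; rewrite invr_ge0 exprn_ge0.
by apply: eq_esum => t _; exact: sumEFin.
Qed.

(** * Passage to the limit *)

Lemma sum_pair_antidiagonal (V : nmodType) n (F : nat -> nat -> V) :
  \sum_(pq : 'I_n.+1 * 'I_n.+1 | (pq.1 + pq.2)%N == n) F pq.1 pq.2 =
  \sum_(p < n.+1) F p (n - p)%N.
Proof.
rewrite -(pair_big_dep predT (fun p q : 'I_n.+1 => (p + q)%N == n)
  (fun p q : 'I_n.+1 => F p q)) /=.
apply: eq_bigr => p _; rewrite (big_pred1 (rev_ord p)) /= ?subSS // => q.
rewrite /= -val_eqE /= subSS; have := ltn_ord p; lia.
Qed.

Theorem theorem5 (R : realType) (m n k : nat)
    (hm : (2 <= m)%N) (hn : (0 < n)%N) (hk : (1 <= k <= n)%N) :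
  Esum R m n k =
  (\sum_(pq : 'I_n.+1 * 'I_n.+1 | (pq.1 + pq.2)%N == n)
     (-1) ^ (pq.1%:Z - k%:Z) * ('C(pq.1, k))%:R
     * bellP pq.1 (fun i => (-1) ^+ i.+1 * zeta R (i * m))
     * bellP pq.2 (fun i => zeta R (i * m)))%:E.
Proof.
rewrite EsumE (sum_pair_antidiagonal n (fun p q =>
  (-1) ^ (p%:Z - k%:Z) * ('C(p, k))%:R
  * bellP p (fun i => (-1) ^+ i.+1 * zeta R (i * m))
  * bellP q (fun i => zeta R (i * m)))).
have f0 (t : {ffun 'I_k -> nat}) : 0 <= composition_sum R m n t.
  by apply: sumr_ge0 => a _; apply: prodr_ge0 => i _; rewrite invr_ge0 exprn_ge0.
pose u s : R := s.+1%:R ^- m.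
have power_sum N i : \sum_(s < N) u s ^+ i = \sum_(s < N) (s.+1%:R : R) ^- (i * m).
  by apply: eq_bigr => s _; rewrite /u exprVn -exprM mulnC.
have zeta_lim i : (0 < i)%N ->
    (fun N => \sum_(s < N) u s ^+ i) @ \oo --> zeta R (i * m).
  move=> i0; under eq_fun do rewrite power_sum.
  by apply: cvg_zeta; rewrite (leq_trans hm) // leq_pmull.
(* Both sides are shown to be limits of the same sums, truncated to indices at most [N]. *)
apply: (cvg_unique _ (@esum_increasing_indices _ k
  (fun t => (composition_sum R m n t)%:E) f0)) => //.
rewrite /=; under eq_fun do rewrite (@esum_bounded_indices _ k _
  (fun t : {ffun 'I_k -> nat} => composition_sum R m n t) f0).
(* The truncated sums are finite, so the remaining limit is taken in [R]. *)
apply: cvg_EFin; first exact: nearW.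
have fE N : \sum_(S : {set 'I_N} | #|S| == k)
      composition_sum R m n (subset_indices k S) =
    \sum_(S : {set 'I_N} | #|S| == k)
     (\prod_(s in S) \sum_(c < n.+1 | (0 < c)%N) u s ^+ c *: 'X^c)`_n.
  by apply: eq_bigr => S /eqP; exact: sum_compositions.
rewrite /comp /=; under eq_fun do rewrite fE sum_subsets_coef.
apply: cvg_big => [|p _]; first exact: add_continuous.
apply: cvgM; last by apply: cvg_bellP.
apply: cvgM; first exact: cvg_cst.
apply: cvg_bellP => i i0; apply: cvgM; first exact: cvg_cst.
exact: zeta_lim.
Qed.
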